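(* Let $S$ be a semigroup with zero, and let $D$ be one of $\overrightarrow{\Gamma}(S)$, $\overrightarrow{\Gamma}_{E}(S)$, and $\overrightarrow{\mathrm{AG}}(S)$. (1) $\mathrm{kd}(D)=1$ if and only if $D$ contains an arc $x\to y$ with $x^{2}=yx$ and $xy=y^{2}$. (2) If $x,y\in Z(S)^{*}$ are distinct with $x^{2}=y^{2}=xy=yx=0$, then $\mathrm{kd}(\overrightarrow{\Gamma}(S))=\mathrm{kd}(\overrightarrow{\Gamma}_{E}(S))=1$, and $\mathrm{kd}(\overrightarrow{\mathrm{AG}}(S))=1$ whenever $Z(S)\neq S$. (3) If $\overrightarrow{\Gamma}(S)$ contains a left path and $Z(S)\neq S$, then $\overrightarrow{\Gamma}_{E}(S)$ and $\overrightarrow{\mathrm{AG}}(S)$ contain left paths, and $\mathrm{kd}(\overrightarrow{\mathrm{AG}}(S))\leq\mathrm{kd}(\overrightarrow{\Gamma}(S))$ and $\mathrm{kd}(\overrightarrow{\Gamma}_{E}(S))\leq\mathrm{kd}(\overrightarrow{\Gamma}(S))$.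
   Context: Let $S$ be a semigroup with zero, not necessarily commutative; for $A\subseteq S$, $A^{*}=A\setminus\{0\}$. An element $x\in S$ is a left (resp. right) zero divisor if $xy=0$ (resp. $yx=0$) for some $y\in S^{*}$; $Z(S)$ is the set of all elements that are left or right zero divisors. For $x\in S$, $\mathrm{Ann}_{l}(x)=\{s\in S: sx=0\}$ and $\mathrm{Ann}_{r}(x)=\{s\in S: xs=0\}$. The following are simple digraphs (no loops, no multiple arcs), all with vertex set $Z(S)^{*}$; for distinct $x,y\in Z(S)^{*}$: in the zero-divisor digraph $\overrightarrow{\Gamma}(S)$, $x\to y$ is an arc iff $xy=0$; in the extended zero-divisor digraph $\overrightarrow{\Gamma}_{E}(S)$, $x\to y$ is an arc iff $x^{n}y^{m}=0$ for some positive integers $n,m$ with $x^{n}\neq 0$ and $y^{m}\neq 0$; in the annihilator digraph $\overrightarrow{\mathrm{AG}}(S)$, $x\to y$ is an arc iff $\mathrm{Ann}_{l}(xy)\setminus(\mathrm{Ann}_{l}(x)\cup\mathrm{Ann}_{l}(y))\neq\emptyset$ or $\mathrm{Ann}_{r}(xy)\setminus(\mathrm{Ann}_{r}(x)\cup\mathrm{Ann}_{r}(y))\neq\emptyset$. For a digraph $D$ whose vertex set is contained in $S$, a (directed) left path in $D$ is a directed path $x_{1}\to x_{2}\to\cdots\to x_{n}$ in $D$ with $n\geq 2$ such that $x_{1}\neq x_{n}$ and $x_{1}x_{i}=x_{n}x_{i}$ for all $i\in\{1,2,\ldots,n\}$; its length is $n-1$. If $D$ contains a left path, the knit degree $\mathrm{kd}(D)$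 is the length of a shortest left path of $D$ (it is defined only in that case, so ''$\mathrm{kd}(D)=1$'' includes the existence of a left path). *)

(* Defs.v *)
From HB Require Import structures.
From mathcomp Require Import all_boot.
From mathcomp Require Import boolp classical_sets.

Set Implicit Arguments.
Unset Strict Implicit.
Unset Printing Implicit Defensive.

Local Open Scope classical_set_scope.
Local Open Scope group_scope.

HB.mixin Record Semigroup_hasZero S of Semigroup S := {
  szero : S;
  mul0s : left_zero szero (@mul S);
  muls0 : right_zero szero (@mul S);
}.

#[short(type="semigroup0Type")]
HB.structure Definition SemigroupWithZero :=
  {S of Semigroup S & Semigroup_hasZero S}.

Section Annihilators.
Variable S : semigroup0Type.
Implicit Types x y : S.

Definition left_zero_divisor x := exists2 y : S, y != szero & x * y = szero.

Definition right_zero_divisor x := exists2 y : S, y != szero & y * x = szero.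

Definition Ann_l x : set S := [set s | s * x = szero].

Definition Ann_r x : set S := [set s | x * s = szero].

(* A semigroup need not have a unit, so [x ^+ n] is not available; only
   [n > 0] is meaningful, the value at [n = 0] being junk. *)
Definition spow x n : S := iterop n *%g x szero.

End Annihilators.

Definition zdiv (S : semigroup0Type) : set S :=
  [set x | left_zero_divisor x \/ right_zero_divisor x].
Arguments zdiv : clear implicits.

Record digraph (T : choiceType) := Digraph {
  vertex : set T;
  darc : rel T;
  arc_vertex : forall x y, darc x y -> vertex x /\ vertex y;
  arc_irrefl : irreflexive darc
}.

Section Restriction.
Variables (T : choiceType) (V : set T) (R : T -> T -> Prop).

Definition restr_arc : rel T := fun x y => `[< [/\ V x, V y, x != y & R x y] >].

Lemma restr_arc_vertex x y : restr_arc x y -> V x /\ V y.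
Proof. by move/asboolP => []. Qed.

Lemma restr_arc_irrefl : irreflexive restr_arc.
Proof. by move=> x; apply/asboolP => -[_ _ /eqP]. Qed.

Definition restr_digraph : digraph T :=
  Digraph restr_arc_vertex restr_arc_irrefl.

End Restriction.

Section Digraphs.
Variable S : semigroup0Type.

Definition zero_divisor_digraph : digraph S :=
  restr_digraph (zdiv S `\ szero) (fun x y => x * y = szero).

Definition ext_zero_divisor_digraph : digraph S :=
  restr_digraph (zdiv S `\ szero) (fun x y => exists n m : nat,
    [/\ (0 < n)%N, (0 < m)%N, spow x n * spow y m = szero,
        spow x n != szero & spow y m != szero]).

Definition annihilator_digraph : digraph S :=
  restr_digraph (zdiv S `\ szero) (fun x y =>
    Ann_l (x * y) `\` (Ann_l x `|` Ann_l y) !=set0 \/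
    Ann_r (x * y) `\` (Ann_r x `|` Ann_r y) !=set0).

End Digraphs.
Arguments zero_divisor_digraph : clear implicits.
Arguments ext_zero_divisor_digraph : clear implicits.
Arguments annihilator_digraph : clear implicits.

Section KnitDegree.
Variables (S : semigroup0Type) (D : digraph S).

(* The left path has vertex sequence [x :: p], hence length [size p]. *)
Definition left_path (x : S) (p : seq S) : Prop :=
  [/\ (0 < size p)%N, path (darc D) x p, uniq (x :: p), x != last x p
    & forall y, y \in x :: p -> x * y = last x p * y].

Definition has_left_path : Prop := exists x p, left_path x p.

Definition left_path_length : pred nat :=
  fun n => `[< exists x p, left_path x p /\ size p = n >].

(* [None] stands for an undefined knit degree. *)
Definition kd : option nat :=
  if pselect (exists n, left_path_length n) is left h
  then Some (ex_minn h) else None.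

End KnitDegree.

(* Main.v *)
Require Import Defs.
From HB Require Import structures.
From mathcomp Require Import all_boot.
From mathcomp Require Import boolp classical_sets.

Set Implicit Arguments.
Unset Strict Implicit.
Unset Printing Implicit Defensive.

Local Open Scope classical_set_scope.
Local Open Scope group_scope.

(** Everything follows from two remarks.

    A left path of length one is a single arc [x -> y] whose two vertices are
    not separated by left multiplication by [x] and [y], and no left path is
    shorter; so knit degree one means that such an arc exists
    ([kd_eq1P]).  When all products of two distinct zero divisors [x] and [y]
    vanish, the separation condition is automatic and it remains to see that
    [x -> y] is an arc of the digraph at hand.

    The zero-divisor digraph is a subdigraph of the extended one, taking both
    exponents equal to one ([sub_zero_ext]), and of the annihilator digraph as
    soon as some [s] is not a zero divisor ([sub_zero_ann]): if [x * y] is zero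
    then [s] annihilates [x * y] but neither [x] nor [y].  The other conditions
    on a left path concern the multiplication of the semigroup alone, so a left
    path survives in every larger digraph and the knit degree can only decrease
    ([sub_kd]). *)

Section KnitDegreeTheory.
Variable S : semigroup0Type.
Implicit Types (D : digraph S) (x y : S).

Lemma kdP D : has_left_path D ->
  exists k, [/\ kd D = Some k, left_path_length D k
               & forall n, left_path_length D n -> (k <= n)%N].
Proof.
move=> [x [p xp]]; rewrite /kd; case: pselect => [h|[]]; last first.
  by exists (size p); apply/asboolP; exists x, p.
by case: ex_minnP => k kD kmin; exists k.
Qed.

Lemma left_path_length_kd D k : kd D = Some k -> left_path_length D k.
Proof.
by rewrite /kd; case: pselect => // h [<-]; case: ex_minnP.
Qed.

Lemma left_path_length1P D : left_path_length D 1%N <->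
  exists x y, [/\ darc D x y, x * x = y * x & x * y = y * y].
Proof.
split=> [/asboolP[x [[|y [|z p]] [xp //= _]]]|[x [y [xy xx yy]]]].
  case: xp => _ /andP[xy _] _ _ e; exists x, y.
  by split=> //; apply: e; rewrite !inE eqxx ?orbT.
have xDy : x != y.
  by apply/eqP => exy; move: xy; rewrite exy arc_irrefl.
apply/asboolP; exists x, [:: y]; split=> //; split=> //=.
- by rewrite xy.
- by rewrite inE xDy.
- by move=> z; rewrite !inE => /orP[] /eqP->.
Qed.

Lemma left_path_length_gt0 D n : left_path_length D n -> (0 < n)%N.
Proof. by move=> /asboolP[x [p [[+ _ _ _ _] <-]]]. Qed.

(** One is the least length that a left path can have, so it suffices that
    it be attained. *)
Lemma kd_eq1P D : kd D = Some 1%N <->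
  exists x y, [/\ darc D x y, x * x = y * x & x * y = y * y].
Proof.
split=> [/left_path_length_kd/left_path_length1P//|/left_path_length1P l1].
have /kdP[k [-> lk kmin]] : has_left_path D.
  by move/asboolP: l1 => [x [p [xp _]]]; exists x, p.
by congr Some; apply/eqP; rewrite eqn_leq kmin// (left_path_length_gt0 lk).
Qed.

Lemma sub_left_path D D' x p : subrel (darc D) (darc D') ->
  left_path D x p -> left_path D' x p.
Proof. by move=> DD' [p0 xp *]; split=> //; apply: sub_path xp. Qed.

Lemma sub_has_left_path D D' : subrel (darc D) (darc D') ->
  has_left_path D -> has_left_path D'.
Proof. by move=> DD' [x [p /(sub_left_path DD') ?]]; exists x, p. Qed.

Lemma sub_kd D D' k k' : subrel (darc D) (darc D') ->
  kd D = Some k -> kd D' = Some k' -> (k' <= k)%N.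
Proof.
move=> DD' /left_path_length_kd/asboolP[x [p [/(sub_left_path DD') xp <-]]].
have /kdP[n [-> _ nmin]] : has_left_path D' by exists x, p.
by move=> [<-]; apply: nmin; apply/asboolP; exists x, p.
Qed.

End KnitDegreeTheory.

Section Subdigraphs.
Variable S : semigroup0Type.

Lemma sub_zero_ext :
  subrel (darc (zero_divisor_digraph S)) (darc (ext_zero_divisor_digraph S)).
Proof.
move=> x y /asboolP[Vx Vy xDy xy]; apply/asboolP; split=> //.
by exists 1%N, 1%N; split=> //; apply/eqP; [case: Vx | case: Vy].
Qed.

(** Without an element outside [zdiv S] this can fail: when all products are
    zero, every annihilator is [S] and the annihilator digraph has no arc. *)
Lemma sub_zero_ann : zdiv S <> setT ->
  subrel (darc (zero_divisor_digraph S)) (darc (annihilator_digraph S)).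
Proof.
move=> /eqP/setTPn[s sZ] x y /asboolP[Vx Vy xDy xy].
apply/asboolP; split=> //; left; exists s; split.
  by rewrite /Ann_l /= xy muls0.
have regular z : (zdiv S `\ szero) z -> s * z <> szero.
  by move=> [_ /eqP z0] sz; apply: sZ; left; exists z.
by move=> [] /=; apply: regular.
Qed.

End Subdigraphs.

Theorem proposition5p8 (S : semigroup0Type) :
  [/\ forall D : digraph S,
        [\/ D = zero_divisor_digraph S,
            D = ext_zero_divisor_digraph S
          | D = annihilator_digraph S] ->
        (kd D = Some 1%N <->
         exists x y : S, [/\ darc D x y, x * x = y * x & x * y = y * y]),
      forall x y : S,
        (zdiv S `\ szero) x -> (zdiv S `\ szero) y -> x != y ->
        x * x = szero -> y * y = szero -> x * y = szero -> y * x = szero ->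
        [/\ kd (zero_divisor_digraph S) = Some 1%N,
            kd (ext_zero_divisor_digraph S) = Some 1%N
          & zdiv S <> setT -> kd (annihilator_digraph S) = Some 1%N]
    & has_left_path (zero_divisor_digraph S) -> zdiv S <> setT ->
        [/\ has_left_path (ext_zero_divisor_digraph S),
            has_left_path (annihilator_digraph S)
          & exists k kE kA : nat,
              [/\ kd (zero_divisor_digraph S) = Some k,
                  kd (ext_zero_divisor_digraph S) = Some kE,
                  kd (annihilator_digraph S) = Some kA,
                  (kA <= k)%N
                & (kE <= k)%N]]].
Proof.
split.
- by move=> D _; apply: kd_eq1P.
- move=> x y Vx Vy xDy xx yy xy yx.
  have arc : darc (zero_divisor_digraph S) x y by apply/asboolP.
  have kd1 D : subrel (darc (zero_divisor_digraph S)) (darc D) ->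
      kd D = Some 1%N.
    by move=> sD; apply/kd_eq1P; exists x, y; rewrite xx yy xy yx sD.
  split; [exact: kd1 | exact/kd1/sub_zero_ext|].
  by move=> ZS; exact/kd1/sub_zero_ann.
- move=> lp /sub_zero_ann sA; have sE := @sub_zero_ext S.
  have lpE := sub_has_left_path sE lp; have lpA := sub_has_left_path sA lp.
  split=> //.
  have [[k [kdk _ _]] [kE [kdE _ _]] [kA [kdA _ _]]] :=
    And3 (kdP lp) (kdP lpE) (kdP lpA).
  exists k, kE, kA; split=> //; first exact: sub_kd sA kdk kdA.
  exact: sub_kd sE kdk kdE.
Qed.
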